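(* Let $N=(B,E,F)$ be a locally finite, K-dense causal net, and let $L(N)$ be its lattice of closed sets. (a) Let $\tau=\{b_1,\ldots,b_i,\ldots\}$ be a B-cut of $N$, and for each $b_i\in\tau$ let $\beta_i=\{b_i\}''$. Then the closed sets $\beta_i$ are pairwise orthogonal in $L(N)$ (that is, pairwise concurrent in $N$), their join in $L(N)$ is $B\cup E$, and $\{\beta_1,\ldots,\beta_i,\ldots\}$ is the set of atoms of a (maximal) Boolean subalgebra of $L(N)$. (b) More generally, given a family $(A_i)_{i\in I}$ of pairwise orthogonal (concurrent) closed sets such that $\bigvee_{i\in I}A_i=B\cup E$, there is a Boolean subalgebra of $L(N)$ such that the $A_i$, $i\in I$, are its atoms.
   Context: A net is a triple $N=(B,E,F)$ where $B$ (conditions) and $E$ (events) are countable disjoint sets, $F\subseteq (B\times E)\cup(E\times B)$, and $\mathrm{dom}(F)\cup\mathrm{ran}(F)=B\cup E$. For $x\in B\cup E$ put ${}^\bullet x=\{y : (y,x)\in F\}$ and $x^\bullet=\{y : (x,y)\in F\}$. Let $F^+$ be the transitive closure of $F$ and $F^*$ its reflexive-transitive closure. $N$ is a causal net if every $b\in B$ satisfies $|{}^\bullet b|\le 1$ and $|b^\bullet|\le 1$, and for all $x,y\in B\cup E$, $(x,y)\in F^+$ implies $(y,x)\notin F^+$. Put $X=B\cup E$ and $\sqsubseteq\,=F^*$; then $(X,\sqsubseteq)$ is a partially ordered set. $N$ is locally finite if every interval $[x,y]=\{z : x\sqsubseteq z\sqsubseteq y\}$ is finite and, for all $x\in X$,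 ${}^\bullet x$ and $x^\bullet$ are finite. Define $\mathbf{li}=\,\sqsubseteq\cup\sqsubseteq^{-1}$ (comparability) and $\mathbf{co}=(X\times X)\setminus\mathbf{li}$ (concurrency). Two subsets of $X$ are concurrent if every element of one is $\mathbf{co}$-related to every element of the other. A line is a maximal set of pairwise $\mathbf{li}$-related elements (maximal chain); a cut is a maximal set of pairwise $\mathbf{co}\cup\mathrm{id}_X$-related elements (maximal antichain). A B-cut is a cut consisting only of conditions. $N$ is K-dense if every cut and every line of $(X,\sqsubseteq)$ have non-empty intersection. For $A\subseteq X$ let $A'=\{x\in X : \forall y\in A,\ x\ \mathbf{co}\ y\}$. $A$ is closed if $A=A''$, and $L(N)$ is the family of closed subsets of $X$. Ordered by inclusion, with orthocomplementation $A\mapsto A'$, minimum $\emptyset$ and maximum $X$, $L(N)$ is a complete orthocomplemented lattice (in fact orthomodular: $A\subseteq C$ implies $C=A\vee(C\wedge A')$), in which the meet is intersection and the join of a family $(A_i)$ is $(\bigcup_i A_i)''$. Closed sets $A,C$ are orthogonal if $A\subseteq C'$. A Boolean subalgebra of $L(N)$ is a subset of $L(N)$ containing $\emptyset$ and $X$, closed under $(\cdot)'$ and under binary meet and join of $L(N)$, which is a Boolean algebra with these operations; it is maximal if it is not properly contained in another Boolean subalgebra of $L(N)$.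
   Formalization: In (a), ''maximal'' is false in general; it is proved only when every β_i is an atom of L(N) (otherwise only maximality among Boolean subalgebras with atoms {β_i}). In (b), the atoms are the non-empty A_i, since an empty A_i cannot be an atom. *)

(* Defs.v *)
From Stdlib Require Import Relations.
From mathcomp Require Import all_boot boolp classical_sets cardinality.

Set Implicit Arguments.
Unset Strict Implicit.
Unset Printing Implicit Defensive.

Local Open Scope classical_set_scope.

Definition maximal_in (T : Type) (P : set T -> Prop) (S : set T) : Prop :=
  P S /\ forall S', P S' -> S `<=` S' -> S' = S.

(* Conditions and events are two separate types, so that B and E are disjoint
   by construction and B `|` E is the sum type [cond + event]. *)
Record net := Net {
  cond : Type;
  event : Type;
  flow : relation (cond + event);
  countable_cond : countable [set: cond];
  countable_event : countable [set: event];
  flow_bipartite : forall x y, flow x y ->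
    match x, y with
    | inl _, inr _ | inr _, inl _ => True
    | _, _ => False
    end;
  flow_total : forall x, exists y, flow x y \/ flow y x
}.

Definition elt (N : net) : Type := (cond N + event N)%type.

Definition preset (N : net) (x : elt N) : set (elt N) :=
  [set y | flow y x].

Definition postset (N : net) (x : elt N) : set (elt N) :=
  [set y | flow x y].

Definition flow_plus (N : net) : relation (elt N) :=
  clos_trans (elt N) (@flow N).

Definition causal_net (N : net) : Prop :=
  (forall b : cond N,
     is_subset1 (@preset N (inl b)) /\ is_subset1 (@postset N (inl b))) /\
  (forall x y : elt N, flow_plus x y -> ~ flow_plus y x).

Definition below (N : net) : relation (elt N) :=
  clos_refl_trans (elt N) (@flow N).

Definition locally_finite (N : net) : Prop :=
  (forall x y : elt N, finite_set [set z | below x z /\ below z y]) /\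
  (forall x : elt N, finite_set (preset x) /\ finite_set (postset x)).

Definition li (N : net) (x y : elt N) : Prop := below x y \/ below y x.

Definition co (N : net) (x y : elt N) : Prop := ~ li x y.

Definition concurrent (N : net) (A C : set (elt N)) : Prop :=
  forall x y, A x -> C y -> co x y.

Definition line (N : net) : set (elt N) -> Prop :=
  maximal_in (fun S => forall x y, S x -> S y -> li x y).

Definition cut (N : net) : set (elt N) -> Prop :=
  maximal_in (fun S => forall x y, S x -> S y -> co x y \/ x = y).

Definition B_cut (N : net) (S : set (elt N)) : Prop :=
  cut S /\ S `<=` range inl.

Definition K_dense (N : net) : Prop :=
  forall S l : set (elt N), cut S -> line l -> S `&` l !=set0.

(* A' *)
Definition ocompl (N : net) (A : set (elt N)) : set (elt N) :=
  [set x | forall y, A y -> co x y].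

(* A'' *)
Definition cl (N : net) (A : set (elt N)) : set (elt N) := ocompl (ocompl A).

(* L(N); its order is inclusion, its meet is intersection. *)
Definition closed_sets (N : net) : set (set (elt N)) :=
  [set A | A = cl A].

Arguments closed_sets : clear implicits.

Definition join (N : net) (A C : set (elt N)) : set (elt N) := cl (A `|` C).

Definition bigjoin (N : net) (I : Type) (D : set I) (A : I -> set (elt N)) :
    set (elt N) :=
  cl (\bigcup_(i in D) A i).

Definition orthogonal (N : net) (A C : set (elt N)) : Prop :=
  A `<=` ocompl C.

(* The lattice identities of a Boolean algebra hold in all of L(N); what has to
   be required are distributivity (one law implies its dual) and the
   complement laws. *)
Definition boolean_subalgebra (N : net) (M : set (set (elt N))) : Prop :=
  [/\ M `<=` closed_sets N,
      M set0 /\ M setT,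
      (forall A, M A -> M (ocompl A)),
      (forall A C, M A -> M C -> M (A `&` C) /\ M (join A C)) &
      (forall A C D, M A -> M C -> M D ->
         A `&` join C D = join (A `&` C) (A `&` D)) /\
      (forall A, M A -> A `&` ocompl A = set0 /\ join A (ocompl A) = setT)].

(* Pitfall: the algebra whose atoms are the {b}'', b in a B-cut, can fail to be
   maximal. With two conditions x, y entering an event e with output b, the
   B-cut {b} has {b}'' = X, so its algebra is {0, X}, which is properly contained
   in {0, {x}, {y}, X}: here {b}'' is not an atom of L(N). *)
Definition maximal_boolean_subalgebra (N : net) : set (set (elt N)) -> Prop :=
  maximal_in (@boolean_subalgebra N).

Arguments maximal_boolean_subalgebra : clear implicits.

(* The minimal non-empty members of a family of sets M; used both for Boolean
   subalgebras of L(N) and for L(N) itself. An empty member of a family of closed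
   sets is never an atom. *)
Definition atoms (T : Type) (M : set (set T)) : set (set T) :=
  [set A | [/\ M A, A !=set0 &
              forall C, M C -> C `<=` A -> C = set0 \/ C = A]].

(* Main.v *)
(** The only deep point is orthomodularity of L(N): if A is contained in a
    closed D and no element of D is concurrent to all of A, then D is contained in the
    closure of A.  Otherwise some x in D is comparable to some v in A', and one
    walks along the flow from x to v.  Since conditions do not branch, each step
    of the flow is either the only one leaving its source or the only one
    entering its target, and this keeps the walk inside D until it enters A', a
    contradiction.

    By orthomodularity, the joins of complementary subfamilies of a pairwise
    orthogonal family F with join X are orthocomplements of each other, so that
    G |-> \/G is a homomorphism from the powerset of F to L(N), whose image is
    the required Boolean subalgebra. *)

From Stdlib Require Import Relations.
Require Import Defs.
From mathcomp Require Import all_boot boolp classical_sets cardinality.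

Local Open Scope classical_set_scope.

(** * Walks along a non-branching relation *)

Section NonBranching.
Context {T : Type} (R : relation T).

(** Stated edge by edge, the property is invariant under reversal and allows branching at events. *)
Definition non_branching : Prop := forall x y, R x y ->
  (forall z, R x z -> z = y) \/ (forall z, R z y -> z = x).

Local Notation le := (clos_refl_trans T R).

(** [ocompl] for an arbitrary relation, so that the walk can also run against the flow. *)
Definition incomparable_to (A : set T) : set T :=
  [set x | forall y, A y -> ~ (le x y \/ le y x)].

Lemma clos_rt_headE x y : le x y -> x = y \/ exists2 z, R x z & le z y.
Proof.
move=> xy; case: (clos_rt_rt1n _ _ _ _ xy) => [|z w xz zw]; first by left.
by right; exists z => //; apply: clos_rt1n_rt.
Qed.

Lemma clos_rt_lastE x y : le x y -> x = y \/ exists2 z, R z y & le x z.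
Proof.
move=> xy; case: (clos_rt_rtn1 _ _ _ _ xy) => [|z w zw xz]; first by left.
by right; exists z => //; apply: clos_rtn1_rt.
Qed.

Lemma non_branching_walk (A D : set T) x v :
  non_branching -> A `<=` D ->
  incomparable_to (incomparable_to D) `<=` D ->
  D x -> incomparable_to A v -> le x v ->
  D `&` incomparable_to A !=set0.
Proof.
move=> nbR AD clD Dx Av xv.
have {}xv := clos_rt_rt1n _ _ _ _ xv;
elim: xv Av Dx => {x v} [x | x y v Rxy yv IH] Av Dx; first by exists x.
have xy : le x y by apply: rt_step.
have xv : le x v by apply: (rt_trans _ _ _ y) => //; apply: clos_rt1n_rt.
have [Dy|nDy] := pselect (D y); first exact: IH.
have [Ax|/existsNP[a /not_implyP[Aa /contrapT ax]]] :=
  pselect (incomparable_to A x); first by exists x.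
have /existsNP[w /not_implyP[Dw /contrapT yw]] :
  ~ incomparable_to (incomparable_to D) y by move=> /clD.
(* Were [a] below [x], it would be below [v], which is incomparable to all of [A]. *)
have {ax} xa : le x a.
  by case: ax => // ax; case: (Av a Aa); right; apply: rt_trans ax xv.
have {yw} wy : le w y.
  by case: yw => // yw; case: (Dw x Dx); right; apply: rt_trans xy yw.
(* If [y] is the only successor of [x], it lies between [x] and [a], hence in [D], since closed sets
   are convex. If [x] is the only predecessor of [y], then [w] is [y] or lies below [x], so it is
   comparable to [x] in [D]. *)
have [succx|predy] := nbR _ _ Rxy.
  case: (clos_rt_headE _ _ xa) => [xaE|[z /succx -> ya]].
    by case: (Av a Aa); right; rewrite -xaE.
  case: nDy; apply: clD => u Du [yu|uy].
    by case: (Du x Dx); right; apply: rt_trans xy yu.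
  by case: (Du a (AD _ Aa)); left; apply: rt_trans uy ya.
case: (clos_rt_lastE _ _ wy) => [wyE|[z /predy -> wx]].
  by case: (Dw x Dx); right; rewrite wyE.
by case: (Dw x Dx); left.
Qed.

End NonBranching.

(** * Order reversal *)

Section Reversal.
Context {T : Type} (R : relation T).

Lemma clos_rt_transp x y :
  clos_refl_trans T (transp T R) x y <-> clos_refl_trans T R y x.
Proof.
split; elim=> *;
  by [apply: rt_step | apply: rt_refl | apply: rt_trans; eassumption].
Qed.

Lemma incomparable_to_transp : incomparable_to (transp T R) = incomparable_to R.
Proof.
apply/funext => A; apply/seteqP; split=> x Ax y Ay xy; apply: (Ax y Ay);
  by case: xy => /clos_rt_transp; [right|left].
Qed.

Lemma non_branching_transp : non_branching R -> non_branching (transp T R).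
Proof. by move=> nbR x y /nbR [|]; [right|left]. Qed.

End Reversal.

(** * The polarity of concurrency, and orthomodularity *)

Section ClosedSets.
Context {N : net}.
Implicit Types A C D : set (elt N).

Lemma li_refl (x : elt N) : li x x.
Proof. by left; apply: rt_refl. Qed.

Lemma co_sym (x y : elt N) : co x y -> co y x.
Proof. by move=> xy [yx|yx]; apply: xy; [right|left]. Qed.

Lemma ocomplS A C : A `<=` C -> ocompl C `<=` ocompl A.
Proof. by move=> sAC x Cx y /sAC; apply: Cx. Qed.

Lemma sub_cl A : A `<=` cl A.
Proof. by move=> x Ax y Ay; apply: co_sym; apply: Ay. Qed.

Lemma sub_ocomplC A C : A `<=` ocompl C -> C `<=` ocompl A.
Proof. by move=> sAC x Cx y Ay; apply: co_sym; apply: sAC. Qed.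

Lemma ocomplK A : ocompl (cl A) = ocompl A.
Proof.
by apply/seteqP; split; [apply: ocomplS; apply: sub_cl | apply: sub_cl].
Qed.

Lemma cl_closed A : closed_sets N (cl A).
Proof. by rewrite /closed_sets /= [RHS]/cl ocomplK. Qed.

Lemma cl_sub A C : closed_sets N C -> A `<=` C -> cl A `<=` C.
Proof. by move=> cC sAC; rewrite [X in _ `<=` X]cC; apply/ocomplS/ocomplS. Qed.

Lemma setI_ocompl A : A `&` ocompl A = set0.
Proof.
by rewrite -subset0 => x [Ax Ax']; apply: (Ax' x Ax); apply: li_refl.
Qed.

Lemma ocompl0 : ocompl set0 = [set: elt N].
Proof. by apply/seteqP; split=> // x _ y []. Qed.

Lemma ocomplT : ocompl [set: elt N] = set0.
Proof. by rewrite -(setTI (ocompl _)) setI_ocompl. Qed.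

Lemma cl0 : cl set0 = set0 :> set (elt N).
Proof. by rewrite /cl ocompl0 ocomplT. Qed.

Lemma ocomplU A C : ocompl (A `|` C) = ocompl A `&` ocompl C.
Proof.
apply/seteqP; split=> [x ACx|x [Ax Cx] y [|]]; [|exact: Ax|exact: Cx].
by split=> y Hy; apply: ACx; [left|right].
Qed.

Lemma clU A C : cl (cl A `|` cl C) = cl (A `|` C).
Proof. by rewrite /cl !ocomplU !ocomplK. Qed.

Lemma join_ocompl A : join A (ocompl A) = setT.
Proof. by rewrite /join /cl ocomplU setI_ocompl ocompl0. Qed.

Lemma setI_closed A C : closed_sets N A -> closed_sets N C ->
  A `&` C = ocompl (join (ocompl A) (ocompl C)).
Proof. by move=> cA cC; rewrite ocomplK ocomplU -/(cl A) -/(cl C) -cA -cC. Qed.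

(** Each edge has a condition at one end, and that condition has no other edge on the same side. *)
Lemma causal_non_branching : causal_net N -> non_branching (@flow N).
Proof.
move=> [nb _] [b|e] [c|f] Rxy; have := flow_bipartite Rxy => // _.
  by left=> z Rz; apply: (nb b).2.
by right=> z Rz; apply: (nb c).1.
Qed.

Lemma closed_orthomodular A D : causal_net N -> closed_sets N D ->
  A `<=` D -> D `&` ocompl A = set0 -> D `<=` cl A.
Proof.
move=> /causal_non_branching nbF cD AD DA0 x Dx v Av xv.
suff : D `&` ocompl A !=set0 by rewrite DA0 => -[].
have ocomplE : @ocompl N = incomparable_to (@flow N) by [].
have clD : ocompl (ocompl D) `<=` D by rewrite [X in _ `<=` X]cD.
case: xv => xv; first exact: (non_branching_walk (@flow N) A D x v).
(* When [x] lies above [v], the walk follows the reversed flow, which has the same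
   incomparability. *)
have transpE := incomparable_to_transp (@flow N).
rewrite ocomplE -transpE.
apply: (non_branching_walk (transp _ (@flow N)) A D x v _ AD _ Dx).
- exact: non_branching_transp.
- by rewrite transpE.
- by rewrite transpE.
- exact/clos_rt_transp.
Qed.

End ClosedSets.

(** * The Boolean algebra of joins of an orthogonal family *)

Section GeneratedAlgebra.
Context {N : net} (F : set (set (elt N))).
Hypothesis N_causal : causal_net N.
Hypothesis F_closed : F `<=` closed_sets N.
Hypothesis F_orth : forall A C, F A -> F C -> A <> C -> orthogonal A C.
Hypothesis F_join : bigjoin F id = setT.
Implicit Types G H : set (set (elt N)).

Local Notation sup G := (bigjoin G id).

Definition joins_of : set (set (elt N)) :=
  [set sup G | G in [set G | G `<=` F]].

Lemma bigjoinU G H : sup (G `|` H) = join (sup G) (sup H).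
Proof. by rewrite /join /bigjoin clU bigcup_setU. Qed.

Lemma bigjoin_ub G A : G A -> A `<=` sup G.
Proof. by move=> GA x Ax; apply: sub_cl; exists A. Qed.

Lemma bigjoin_lub G C : closed_sets N C -> (forall A, G A -> A `<=` C) ->
  sup G `<=` C.
Proof. by move=> cC GC; apply: cl_sub => //; apply: bigcup_sub. Qed.

Lemma ocompl_closed (A : set (elt N)) : closed_sets N (ocompl A).
Proof. by rewrite -ocomplK; apply: cl_closed. Qed.

Lemma ocompl_bigjoin G : G `<=` F -> ocompl (sup G) = sup (F `\` G).
Proof.
move=> GF; have sub : sup (F `\` G) `<=` ocompl (sup G).
  apply: bigjoin_lub => [|A [FA nGA]]; first exact: ocompl_closed.
  apply: sub_ocomplC; apply: bigjoin_lub => [|C GC]; first exact: ocompl_closed.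
  by apply: F_orth; [apply: GF | | move=> CA; apply: nGA; rewrite -CA].
apply/seteqP; split=> //.
rewrite [X in _ `<=` X](cl_closed (\bigcup_(A in F `\` G) A)).
apply: closed_orthomodular => //; first exact: ocompl_closed.
(* An element concurrent to both joins would be concurrent to their join, which is the whole net. *)
by rewrite -ocomplU -ocomplK -/(join _ _) -bigjoinU setDUK // F_join ocomplT.
Qed.

(** De Morgan reduces the meet to joins and complements, which are already known to match unions and
    differences. *)
Lemma bigjoinI G H : G `<=` F -> H `<=` F -> sup (G `&` H) = sup G `&` sup H.
Proof.
move=> GF HF; rewrite setI_closed; [|exact: cl_closed..].
rewrite !ocompl_bigjoin // -bigjoinU ocompl_bigjoin; last first.
  by move=> A [[]|[]].
by rewrite -setDIr setDD setIA (setIidr GF).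
Qed.

Lemma bigjoin0 : bigjoin set0 id = set0 :> set (elt N).
Proof. by rewrite /bigjoin bigcup_set0 cl0. Qed.

Lemma bigjoin1 (A : set (elt N)) : closed_sets N A -> sup [set A] = A.
Proof. by rewrite /bigjoin bigcup_set1 => <-. Qed.

Lemma joins_of_gen A : F A -> joins_of A.
Proof.
by move=> FA; exists [set A]; [move=> _ -> | apply/bigjoin1/F_closed].
Qed.

Lemma joins_of_boolean : boolean_subalgebra joins_of.
Proof.
split.
- by move=> _ [G _ <-]; apply: cl_closed.
- by split; [exists set0 => //; apply: bigjoin0 | exists F].
- move=> _ [G GF <-]; exists (F `\` G); first by move=> A [].
  by rewrite ocompl_bigjoin.
- move=> _ _ [G GF <-] [H HF <-]; split.
    by exists (G `&` H); [move=> A [/GF] | rewrite bigjoinI].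
  by exists (G `|` H); [move=> A [/GF|/HF] | rewrite bigjoinU].
- split=> [_ _ _ [G GF <-] [H HF <-] [K KF <-]|A _]; last first.
    by split; [apply: setI_ocompl | apply: join_ocompl].
  (* Distributivity is inherited from that of the subfamilies of [F]. *)
  rewrite -!bigjoinI // -!bigjoinU -bigjoinI ?setIUr //.
  by move=> A [/HF|/KF].
Qed.

Lemma atoms_joins_of : atoms joins_of = F `\ set0.
Proof.
apply/seteqP; split=> [_ [[G GF <-] [x Gx] Gmin]|A [FA A0]]; last first.
  split; [exact: joins_of_gen | exact/set0P/eqP |].
  (* If [A] is not in [G], the join of [G] lies in both [A] and its orthocomplement, so it is
     empty. *)
  move=> _ [G GF <-] GA; have [/bigjoin_ub AG|nGA] := pselect (G A).
    by right; apply/seteqP.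
  left; rewrite -subset0 -(setI_ocompl A) subsetI; split=> //.
  apply: bigjoin_lub => [|C GC]; first exact: ocompl_closed.
  by apply: F_orth => //; [apply: GF | move=> CA; apply: nGA; rewrite -CA].
(* A non-empty join has a non-empty member, which equals it by minimality. *)
have [[A GA A0]|nG] := pselect (exists2 A, G A & A <> set0); last first.
  suff GS0 : sup G `<=` set0 by case: (GS0 x Gx).
  apply: bigjoin_lub => [|A GA y Ay]; first by rewrite /closed_sets /= cl0.
  by case: nG; exists A => // A0; rewrite A0 in Ay.
have [//|<-] := Gmin A (joins_of_gen A (GF A GA)) (bigjoin_ub G A GA).
by split=> //; apply: GF.
Qed.

(** Each [D] in [M] is the join of the members of [F] inside it, because the other members lie in
    the orthocomplement of [D]. The last hypothesis covers both [F] made of atoms of [M] and [F]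
    made of atoms of L(N). *)
Lemma joins_of_maximal (M : set (set (elt N))) :
  boolean_subalgebra M -> joins_of `<=` M ->
  (forall A D, F A -> M D -> D `&` A = set0 \/ D `&` A = A) ->
  M = joins_of.
Proof.
move=> [Mcl _ MC _ [Mdistr _]] FM Mat; apply/seteqP; split=> // D MD.
pose G := [set A | F A /\ A `<=` D].
have GF : G `<=` F by move=> A [].
exists G => //; apply/seteqP; split.
  by apply: bigjoin_lub => [|A []//]; apply: Mcl.
rewrite -[G](setIidr GF) -setDD -ocompl_bigjoin; last by move=> A [].
apply: sub_ocomplC; apply: bigjoin_lub => [|A [FA nGA]].
  exact: ocompl_closed.
have MA : M A by apply/FM/joins_of_gen.
have [DA0|DA] := Mat A D FA MD; last first.
  by case: nGA; split=> //; rewrite -DA => x [].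
(* As [A] misses [D], distributivity makes [A] the closure of its part in [ocompl D]. *)
have := Mdistr A D (ocompl D) MA MD (MC _ MD).
rewrite join_ocompl setIT [A `&` D]setIC DA0 /join set0U => ->.
by apply: cl_sub => [|x []//]; apply: ocompl_closed.
Qed.

End GeneratedAlgebra.

(** * B-cuts and general orthogonal families *)

Theorem mainTheorem2 (N : net) (N_causal : causal_net N)
    (N_locally_finite : locally_finite N) (N_K_dense : K_dense N) :
  (forall tau : set (elt N), B_cut tau ->
     let beta := fun b : elt N => cl [set b] in
     let betas := [set beta b | b in tau] in
     [/\ (forall b, tau b -> closed_sets N (beta b)),
         (forall b c, tau b -> tau c -> b <> c ->
            orthogonal (beta b) (beta c) /\ concurrent (beta b) (beta c)),
         bigjoin tau beta = setT &
         exists M : set (set (elt N)),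
           [/\ boolean_subalgebra M,
               atoms M = betas,
               maximal_in
                 (fun M' => boolean_subalgebra M' /\ atoms M' = betas) M &
               betas `<=` atoms (closed_sets N) ->
               maximal_boolean_subalgebra N M]]) /\
  (forall (I : Type) (A : I -> set (elt N)),
     (forall i, closed_sets N (A i)) ->
     (forall i j, i <> j -> orthogonal (A i) (A j)) ->
     bigjoin setT A = setT ->
     exists M : set (set (elt N)),
       boolean_subalgebra M /\ atoms M = range A `\ set0).
Proof.
split=> [tau [[tau_co tau_max] _] beta betas|I A Acl Aorth Ajoin]; last first.
  exists (joins_of (range A)).
  have rcl : range A `<=` closed_sets N by move=> _ [i _ <-].
  have rorth B C : range A B -> range A C -> B <> C -> orthogonal B C.
    by move=> [i _ <-] [j _ <-] ij; apply: Aorth => e; apply: ij; rewrite e.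
  have rjoin : bigjoin (range A) id = setT by rewrite /bigjoin bigcup_image.
  by split; [apply: joins_of_boolean | apply: atoms_joins_of].
have beta_closed b : closed_sets N (beta b) by apply: cl_closed.
have beta_orth b c : tau b -> tau c -> b <> c -> orthogonal (beta b) (beta c).
  move=> tb tc bc; rewrite /orthogonal /beta ocomplK.
  apply: cl_sub => [|_ -> _ ->]; first exact: ocompl_closed.
  by case: (tau_co b c).
have beta_join : bigjoin tau beta = setT.
  suff tau0 : ocompl (\bigcup_(b in tau) beta b) = set0.
    by rewrite /bigjoin /cl tau0 ocompl0.
  rewrite -subset0 => z Hz.
  have zb b : tau b -> co z b.
    by move=> tb; apply: Hz; exists b => //; apply: sub_cl.
  (* An element concurrent to the whole cut can be added to it, so by maximality it belongs to it
     and is concurrent to itself, which is absurd. *)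
  have tz : tau z.
    suff <- : tau `|` [set z] = tau by right.
    apply: tau_max => [x y [tx|->] [ty|->]|x];
      [exact: tau_co | | | by right | by left].
      by left; apply/co_sym/zb.
    by left; apply: zb.
  exact: zb tz (li_refl z).
split=> //.
  move=> b c tb tc bc; split; first exact: beta_orth.
  by move=> x y bx cy; apply: (beta_orth b c tb tc bc x bx).
have bcl : betas `<=` closed_sets N by move=> _ [b _ <-].
have borth B C : betas B -> betas C -> B <> C -> orthogonal B C.
  move=> [b tb <-] [c tc <-] bc.
  by apply: beta_orth => // e; apply: bc; rewrite e.
have bjoin : bigjoin betas id = setT by rewrite /bigjoin bigcup_image.
have boolM := joins_of_boolean betas N_causal borth bjoin.
have atomsM : atoms (joins_of betas) = betas.
  rewrite atoms_joins_of //; apply/seteqP; split=> [B []//|_ [b tb <-]].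
  split; first by exists b.
  by move=> b0; have : beta b b by [apply: sub_cl]; rewrite b0.
exists (joins_of betas); split=> //.
  split=> // M' [boolM' atomsM'] sub.
  apply: joins_of_maximal => // B D FB MD.
  move: (FB); rewrite -atomsM' => -[MB _]; apply=> //.
  have [_ _ _ /(_ D B MD MB) []] := boolM'; by [].
move=> batoms; split=> // M' boolM' sub.
(* Here [B] is an atom of L(N), and its meet with [D] is closed because it lies in [M']. *)
apply: joins_of_maximal => // B D FB MD.
have [_ _ Bmin] := batoms B FB; apply: Bmin => //.
have [M'cl _ _ M'I _] := boolM'; apply: M'cl; apply: (M'I _ _ MD _).1.
exact/sub/joins_of_gen.
Qed.
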